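(* There is a universal constant $C>0$ such that the following holds. Let $T\subset\mathbb{R}^d$ be nonempty, let $\sigma>0$, and let $\varepsilon>0$ be such that $$\log M^{\mathrm{loc}}_T(\varepsilon)\le\frac{\varepsilon^2}{\sigma^2}.$$ Let $\mathcal{M}_\varepsilon$ be a maximal (global) $\varepsilon$-packing of $T$ in the Euclidean norm. Then the estimator $$\hat\theta(Y)=\operatorname*{arg\,min}_{\eta\in\mathcal{M}_\varepsilon}\|\eta-Y\|_2^2$$ satisfies $$\sup_{\theta^\star\in T}\mathbb{E}_{Y\sim N(\theta^\star,\sigma^2I_d)}\|\hat\theta(Y)-\theta^\star\|_2^2\le C\,\varepsilon^2 .$$
   Context: $B_2^d$ is the closed Euclidean unit ball. For $A,B\subset\mathbb{R}^d$, $M(A,B)=\sup\{|A_0|:A_0\subset A\text{ finite},\ x-y\notin B\text{ for all distinct }x,y\in A_0\}$. For general $T\subset\mathbb{R}^d$ (not necessarily convex), $$M^{\mathrm{loc}}_T(\varepsilon)=\sup_{\delta\ge\varepsilon}\sup_{x\in T}M\big(T\cap(x+2\delta B_2^d),\delta B_2^d\big).$$ An $\varepsilon$-packing of $T$ is a subset of $T$ whose distinct points $x,y$ satisfy $\|x-y\|_2>\varepsilon$; it is maximal if no point of $T$ can be added to it. *)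

(* Defs.v *)
From HB Require Import structures.
From mathcomp Require Import all_boot all_order all_algebra finmap.
From mathcomp Require Import all_classical all_reals all_analysis.

Set Implicit Arguments.
Unset Strict Implicit.
Unset Printing Implicit Defensive.

Import Order.TTheory GRing.Theory Num.Theory.
Import numFieldNormedType.Exports.

Local Open Scope classical_set_scope.
Local Open Scope ring_scope.

(* 'rV[R]_d carries the sigma-algebra generated by the coordinate maps, which
   is the Borel sigma-algebra of R^d. *)
Section measurable_rV.
Context {R : realType} (d : nat).

Let coord (i : 'I_d) (x : 'rV[R]_d) : measurableTypeR R := x 0 i.

Let rV_set0 : g_sigma_preimage coord set0.
Proof. exact: sigma_algebra0. Qed.

Let rV_setC A : g_sigma_preimage coord A -> g_sigma_preimage coord (~` A).
Proof. exact: sigma_algebraC. Qed.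

Let rV_bigcup (F : (set 'rV[R]_d)^nat) :
  (forall i, g_sigma_preimage coord (F i)) ->
  g_sigma_preimage coord (\bigcup_i F i).
Proof. exact: sigma_algebra_bigcup. Qed.

HB.instance Definition _ := @isMeasurable.Build default_measure_display
  'rV[R]_d (g_sigma_preimage coord) rV_set0 rV_setC rV_bigcup.

Lemma measurable_coord (i : 'I_d) :
  measurable_fun [set: 'rV[R]_d] (fun x : 'rV[R]_d => x 0 i : measurableTypeR R).
Proof.
move=> _ Y mY; rewrite setTI; apply: sub_sigma_algebra => /=.
rewrite -bigcup_seq/=; exists i => /=; first by rewrite mem_index_enum.
by exists Y => //; rewrite setTI.
Qed.

Lemma measurable_fun_rV d' (T : measurableType d') (f : T -> 'rV[R]_d) :
  (forall i, measurable_fun [set: T] (fun t => f t 0 i : measurableTypeR R)) ->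
  measurable_fun [set: T] f.
Proof.
move=> mf _ Y mY.
have : g_sigma_preimage coord `<=` image_set_system [set: T] f measurable.
  apply: smallest_sub.
    by apply: sigma_algebra_image; apply: sigma_algebra_measurable.
  move=> A; rewrite -bigcup_seq => -[i _ [B mB <-]]; rewrite /image_set_system/=.
  by have := mf i measurableT _ mB; rewrite !setTI.
by move=> /(_ _ mY).
Qed.

End measurable_rV.

Section rV_cons.
Context {R : realType} (d : nat).

Definition rV_cons (p : measurableTypeR R * 'rV[R]_d) : 'rV[R]_d.+1 :=
  row_mx (p.1%:M : 'rV[R]_1) p.2.

Lemma measurable_rV_cons : measurable_fun setT rV_cons.
Proof.
apply: measurable_fun_rV => i; rewrite /rV_cons.
case: (@splitP 1 d i) => j ij.
  rewrite (_ : i = lshift d j); last exact/val_inj.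
  under eq_fun do rewrite (@row_mxEl _ 1 1 d) mxE (ord1 j) eqxx mulr1n.
  exact: measurable_fst.
rewrite (_ : i = rshift 1 j); last exact/val_inj.
under eq_fun do rewrite (@row_mxEr _ 1 1 d).
exact: (measurableT_comp (measurable_coord j) measurable_snd).
Qed.

HB.instance Definition _ :=
  isMeasurableFun.Build _ _ _ _ rV_cons measurable_rV_cons.

End rV_cons.

(* N(m, s^2 I_d): the product of the one-dimensional laws N(m_i, s^2), see
   isogauss_box; as in [normal_prob], s is the standard deviation. *)
Fixpoint isogauss {R : realType} (s : R) (d : nat) :
    'rV[R]_d -> probability 'rV[R]_d R :=
  match d return 'rV[R]_d -> probability 'rV[R]_d R with
  | 0 => fun m => \d_m
  | n.+1 => fun m =>
      distribution (normal_prob (m 0%R 0%R) s \x isogauss s (@rsubmx R 1 1 n m))%E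
        (@rV_cons R n)
  end.

Lemma isogauss_box {R : realType} (s : R) (d : nat) (m : 'rV[R]_d)
    (B : 'I_d -> set (measurableTypeR R)) : (forall i, measurable (B i)) ->
  isogauss s m [set x | forall i, B i (x 0 i)] =
  (\prod_(i < d) normal_prob (m 0%R i) s (B i))%E.
Proof.
elim: d m B => [|n IHn] m B mB /=.
  by rewrite big_ord0 diracE mem_set// => -[].
rewrite /distribution /pushforward /=.
rewrite (_ : _ @^-1` _ = B ord0 `*` [set x : 'rV[R]_n | forall i, B (lift ord0 i) (x 0 i)]).
  rewrite product_measure1E//.
    rewrite big_ord_recl; congr (_ * _)%E.
    apply: (etrans (IHn (@rsubmx R 1 1 n m) (fun i => B (lift ord0 i)) _)) => //.
    apply: eq_bigr => i _; congr (normal_prob _ _ _).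
    by rewrite mxE; congr (m _ _); apply/val_inj.
  rewrite (_ : [set _ | _] =
      \big[setI/setT]_(i < n) [set x : 'rV[R]_n | B (lift ord0 i) (x 0%R i)]).
    apply: bigsetI_measurable => i _; rewrite -[X in measurable X]setTI.
    exact: (measurable_coord i measurableT (mB _)).
  apply/seteqP; split=> x /= Bx.
    by rewrite -bigcap_seq => i _; exact: Bx.
  by move=> i; move: Bx; rewrite -bigcap_seq => /(_ i); apply; rewrite /= mem_index_enum.
apply/seteqP; rewrite /rV_cons; split=> -[y x] /= => [Bx|[By Bx] i].
  split=> [|i].
    have := Bx ord0; rewrite (_ : ord0 = lshift n (ord0 : 'I_1)); last exact/val_inj.
    by rewrite (@row_mxEl _ 1 1 n) mxE eqxx mulr1n.
  have := Bx (lift ord0 i).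
  rewrite (_ : lift ord0 i = rshift 1 i); last exact/val_inj.
  by rewrite (@row_mxEr _ 1 1 n).
case: (unliftP ord0 i) => [j ->|->].
  move: (Bx j); rewrite (_ : lift ord0 j = rshift 1 j); last exact/val_inj.
  by rewrite (@row_mxEr _ 1 1 n).
move: By; rewrite (_ : ord0 = lshift n (ord0 : 'I_1)); last exact/val_inj.
by rewrite (@row_mxEl _ 1 1 n) mxE eqxx mulr1n.
Qed.

Section packing.
Context {R : realType} {d : nat}.
Local Notation E := 'rV[R]_d.
Implicit Types (A B T P : set E) (x y : E).

Definition norm2 x : R := Num.sqrt (\sum_(i < d) x 0 i ^+ 2).

Definition B2 : set E := [set x | norm2 x <= 1].

Definition dilate (r : R) A : set E := [set r *: x | x in A].

Definition translate x A : set E := [set x + y | y in A].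

(* M(A, B), with values in \bar R: +oo when the cardinalities are unbounded. *)
Definition packing_number A B : \bar R :=
  ereal_sup [set (#|` A0|%:R)%:E | A0 in [set A0 : {fset E} |
    [set` A0] `<=` A /\
    forall x y, x \in A0 -> y \in A0 -> x != y -> ~ B (x - y)]].

Definition Mloc T (eps : R) : \bar R :=
  ereal_sup [set
    ereal_sup [set packing_number (T `&` translate x (dilate (2 * delta) B2))
                                  (dilate delta B2) | x in T]
    | delta in [set delta : R | eps <= delta]].

Definition packing (eps : R) T P :=
  P `<=` T /\ forall x y, P x -> P y -> x <> y -> eps < norm2 (x - y).

Definition maximal_packing (eps : R) T P :=
  packing eps T P /\ forall x, T x -> ~ P x -> ~ packing eps T (x |` P).

End packing.

Definition argmin {R : realType} {U : Type} (A : set U) (f : U -> R) : set U :=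
  [set x | A x /\ forall y, A y -> f x <= f y].

(* Main.v *)
Require Import Defs.
From mathcomp Require Import all_boot all_order all_algebra finmap.
From mathcomp Require Import ring lra zify.
From mathcomp Require Import all_classical all_reals all_analysis.
From mathcomp Require Import measurable_realfun.

Set Implicit Arguments.
Unset Strict Implicit.
Unset Printing Implicit Defensive.

Import Order.TTheory GRing.Theory Num.Theory.
Local Open Scope classical_set_scope.
Local Open Scope ring_scope.

(* Fix theta in T and a point eta0 of the packing with |theta - eta0| <= eps.
   If the estimator picks eta with D = |eta - eta0| >= 64 eps, then comparing
   with eta0 gives <eta - eta0, Y - theta> >= D^2 / 4, so the squared error is
   bounded pointwise by O(eps^2) plus the sum over all far packing points eta of
   2 D^2 exp ((<eta - eta0, Y - theta> - D^2 / 4) / (4 sigma^2)).  By the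
   Gaussian moment generating function each term has mean
   2 D^2 exp (- D^2 / (32 sigma^2)).  With a = eps^2 / sigma^2, the ball of
   radius 2^k eps around eta0 contains at most exp (k a) packing points, and
   a >= 1/2 as soon as there is a far point, so the sum over dyadic annuli
   converges to at most eps^2. *)

(** * Integration against Gaussian laws and their moment generating functions *)

(* f need not be measurable: the integral of a nonnegative function is the
   supremum over the simple functions below it. *)
Lemma ge0_le_integral_lower d (T : measurableType d) (R : realType)
    (mu : {measure set T -> \bar R}) (f g : T -> \bar R) :
  (forall x, 0 <= f x)%E -> (forall x, f x <= g x)%E ->
  (\int[mu]_x f x <= \int[mu]_x g x)%E.
Proof.
move=> f0 fg; rewrite !ge0_integralTE//; last by move=> x; exact: le_trans (fg x).
by apply: ereal_sup_le => _ [h hf <-]; exists h => // x; exact: le_trans (fg x).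
Qed.

(** The Radon-Nikodym derivative of [normal_prob] and [normal_pdf] have the same integral over every
    measurable set, hence agree almost everywhere. *)
Lemma ge0_integral_normal_prob (R : realType) (m s : R)
    (f : measurableTypeR R -> \bar R) :
  (forall x, 0 <= f x)%E -> measurable_fun setT f ->
  (\int[normal_prob m s]_x f x =
   \int[lebesgue_measure]_x (f x * (normal_pdf m s x)%:E))%E.
Proof.
move=> f0 mf; have nmu := normal_prob_dominates m s.
rewrite -(Radon_Nikodym_SigmaFinite.change_of_variables nmu)//.
have irn := Radon_Nikodym_SigmaFinite.f_integrable nmu.
have mrn := measurable_int _ irn.
have mpdf := measurable_int _ (integrable_normal_pdf m s).
apply: ae_eq_integral => //; try exact: emeasurable_funM.
apply: ae_eqe_mul2l; apply: integral_ae_eq => // E _ mE.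
by rewrite -Radon_Nikodym_SigmaFinite.f_integral.
Qed.

(** Completing the square: exp(t x) times the density of mean m is a constant times the density of
    mean m + s^2 t. *)
Lemma normal_mgf (R : realType) (m s t : R) : s != 0 ->
  (\int[normal_prob m s]_x (expR (t * x))%:E =
   (expR (t * m + s ^+ 2 * t ^+ 2 / 2))%:E)%E.
Proof.
move=> s0; rewrite ge0_integral_normal_prob//; last first.
  by apply/measurable_EFinP; apply: measurableT_comp => //; exact: measurable_funM.
pose c := expR (t * m + s ^+ 2 * t ^+ 2 / 2).
transitivity (\int[lebesgue_measure]_x
    (c%:E * (normal_pdf (m + s ^+ 2 * t)%R s x)%:E))%E.
  apply: eq_integral => x _; rewrite -!EFinM !normal_pdfE//; congr EFin.
  rewrite mulrCA [RHS]mulrCA /c /normal_fun -!expRD; congr (_ * expR _).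
  by field.
rewrite ge0_integralZl//=.
- by rewrite integral_normal_pdf mule1.
- exact: measurable_int (integrable_normal_pdf _ _).
- by move=> x _; rewrite lee_fin normal_pdf_ge0.
- by rewrite lee_fin expR_ge0.
Qed.

Lemma measurable_expR_dot (R : realType) d (c : 'rV[R]_d) :
  measurable_fun [set: 'rV[R]_d]
    (fun x : 'rV[R]_d => expR (\sum_i c 0 i * x 0 i)).
Proof.
apply: measurableT_comp => //; apply: measurable_sum => i.
by apply: measurable_funM => //; exact: measurable_coord.
Qed.

(** Induction on the dimension: Tonelli splits off the first coordinate, and the exponential of the
    sum factors. *)
Lemma isogauss_mgf (R : realType) (s : R) d (m c : 'rV[R]_d) : s != 0 ->
  (\int[isogauss s m]_x (expR (\sum_i c 0 i * x 0 i)%R)%:E =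
   (expR (\sum_i c 0 i * m 0 i + s ^+ 2 * (\sum_i c 0 i ^+ 2) / 2)%R)%:E)%E.
Proof.
move=> s0; elim: d m c => [|n IHn] m c.
  rewrite /= integral_dirac//; last first.
    by apply/measurable_EFinP; exact: measurable_expR_dot.
  by rewrite diracT mul1e !big_ord0 mulr0 mul0r addr0.
rewrite /= ge0_integral_pushforward//=; last first.
  by apply/measurable_EFinP; exact: measurable_expR_dot.
pose c' : 'rV[R]_n := @rsubmx R 1 1 n c; pose m' : 'rV[R]_n := @rsubmx R 1 1 n m.
have r0 (x : 'rV[R]_n.+1) i : (@rsubmx R 1 1 n x) 0 i = x 0 (lift ord0 i).
  by rewrite mxE; congr (x _ _); exact/val_inj.
have cE (p : measurableTypeR R * 'rV[R]_n) :
    \sum_i c 0 i * rV_cons p 0 i = c 0 0 * p.1 + \sum_i c' 0 i * p.2 0 i.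
  rewrite big_ord_recl; congr (_ * _ + _).
    rewrite /rV_cons (_ : ord0 = lshift n (ord0 : 'I_1)); last exact/val_inj.
    by rewrite (@row_mxEl _ 1 1 n) mxE eqxx mulr1n.
  apply: eq_bigr => i _; rewrite r0 /rV_cons.
  rewrite [in X in _ * X](_ : lift ord0 i = rshift 1 i); last exact/val_inj.
  by rewrite (@row_mxEr _ 1 1 n).
rewrite preimage_setT fubini_tonelli1//=; last first.
  apply/measurable_EFinP.
  exact: measurableT_comp (measurable_expR_dot c) (@measurable_rV_cons R n).
rewrite /fubini_F.
pose k := expR (\sum_i c' 0 i * m' 0 i + s ^+ 2 * (\sum_i c' 0 i ^+ 2) / 2).
transitivity (\int[normal_prob (m 0%R 0%R) s]_x (k%:E * (expR (c 0 0 * x)%R)%:E))%E.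
  apply: eq_integral => x _ /=.
  transitivity (\int[isogauss s m']_y ((expR (c 0 0 * x)%R)%:E *
      (expR (\sum_i c' 0 i * y 0 i)%R)%:E))%E.
    by apply: eq_integral => y _; rewrite cE expRD EFinM.
  rewrite ge0_integralZl//=.
  - by rewrite IHn muleC.
  - by apply/measurable_EFinP; exact: measurable_expR_dot.
rewrite ge0_integralZl//=.
- rewrite normal_mgf// -EFinM -expRD; congr (expR _)%:E.
  rewrite !big_ord_recl /=.
  under eq_bigr do rewrite !r0.
  under [in X in _ + _ * X / _ + _]eq_bigr do rewrite r0.
  by field.
- apply/measurable_EFinP; apply: measurableT_comp => //; exact: measurable_funM.
- by rewrite lee_fin expR_ge0.
Qed.

(** * The Euclidean norm and its balls *)

Section norm2_theory.
Context {R : realType} {d : nat}.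
Implicit Types x y z : 'rV[R]_d.

Lemma norm2_ge0 x : 0 <= norm2 x. Proof. exact: sqrtr_ge0. Qed.

Lemma sqr_norm2 x : norm2 x ^+ 2 = \sum_i x 0 i ^+ 2.
Proof. by rewrite sqr_sqrtr// sumr_ge0// => i _; exact: sqr_ge0. Qed.

Lemma norm2Z (r : R) x : 0 <= r -> norm2 (r *: x) = r * norm2 x.
Proof.
move=> r0; apply/eqP; rewrite -(eqrXn2 (ltn0Sn 1)) ?mulr_ge0 ?norm2_ge0//.
rewrite exprMn !sqr_norm2 mulr_sumr; apply/eqP/eq_bigr => i _.
by rewrite mxE exprMn.
Qed.

Lemma norm2_distC x y : norm2 (x - y) = norm2 (y - x).
Proof.
rewrite /norm2; congr Num.sqrt; apply: eq_bigr => i _.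
by rewrite !mxE -sqrrN opprB.
Qed.

Lemma norm2_subxx x : norm2 (x - x) = 0.
Proof.
by rewrite /norm2 big1 ?sqrtr0// => i _; rewrite !mxE subrr expr0n.
Qed.

Lemma dilate_B2 (r : R) x : 0 < r -> dilate r B2 x <-> norm2 x <= r.
Proof.
move=> r0; split=> [[y y1 <-]|xr]; first by rewrite norm2Z ?(ltW r0)// ger_pMr.
exists (r^-1 *: x); last by rewrite scalerA divff ?gt_eqF// scale1r.
by rewrite /B2/= norm2Z ?invr_ge0 ?(ltW r0)// mulrC ler_pdivrMr// mul1r.
Qed.

(** Coordinatewise (p - q)^2 <= 2 p^2 + 2 q^2, from (p + q)^2 >= 0. *)
Lemma sqr_norm2D_le x y z :
  norm2 (x - z) ^+ 2 <= 2 * norm2 (x - y) ^+ 2 + 2 * norm2 (z - y) ^+ 2.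
Proof.
rewrite !sqr_norm2 !mulr_sumr -big_split/=; apply: ler_sum => i _.
rewrite !mxE; have := sqr_ge0 (x 0 i - y 0 i + (z 0 i - y 0 i)); nra.
Qed.

End norm2_theory.

(** * Counting packing points in balls from the local entropy *)

(** Union bound by induction on [S']: the points of [S] related to [z] number at most [N], and the
    remaining ones are covered by the other centres. *)
Lemma card_le_cover (R : numDomainType) (K : choiceType)
    (S S' : {fset K}) (P : K -> K -> bool) (N : R) : 0 <= N ->
  (forall y, y \in S -> exists2 z, z \in S' & P z y) ->
  (forall z, z \in S' -> #|` [fset y in S | P z y]%fset|%:R <= N) ->
  #|` S|%:R <= #|` S'|%:R * N.
Proof.
move=> N0; elim/fset1U_rect: S' S => [|z S' zS' IH] S cov bnd.
  suff -> : S = fset0 by rewrite cardfs0 mul0r.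
  by apply/eqP/fset0Pn => -[y /cov[]].
rewrite cardfsU1 zS' -(cardfsID [fset y in S | P z y]%fset S) !natrD mulrDl mul1r.
apply: lerD.
  rewrite (_ : (S `&` _)%fset = [fset y in S | P z y]%fset).
    by apply: bnd; rewrite in_fset1U eqxx.
  by apply/fsetIidPr/fsubsetP => y; rewrite !inE => /andP[].
apply: IH => [y|w wS'].
  rewrite !inE/= => /andP[+ yS]; rewrite yS/= => Pzy.
  have [w] := cov _ yS; rewrite in_fset1U => /orP[/eqP->|].
    by rewrite (negbTE Pzy).
  by exists w.
apply: le_trans (bnd w _); last by rewrite in_fset1U wS' orbT.
rewrite ler_nat; apply/fsubset_leq_card/fsubsetP => y.
by rewrite !inE => /andP[/andP[_ ->] ->].
Qed.

Section local_packing.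
Context {R : realType} {d : nat}.
Implicit Types (T : set 'rV[R]_d) (x y z : 'rV[R]_d) (S : {fset 'rV[R]_d}).

Lemma card_le_Mloc T (eps delta : R) x S : 0 < eps -> eps <= delta -> T x ->
  [set` S] `<=` T -> (forall y, y \in S -> norm2 (y - x) <= 2 * delta) ->
  {in S &, forall y z, y != z -> delta < norm2 (y - z)} ->
  ((#|` S|%:R)%:E <= Mloc T eps)%E.
Proof.
move=> eps0 epsd Tx ST Sx Ssep; have d0 : 0 < delta by exact: lt_le_trans epsd.
apply: le_trans; last by apply: ereal_sup_ubound; exists delta.
apply: le_trans; last by apply: ereal_sup_ubound; exists x.
apply: ereal_sup_ubound; exists S => //; split=> [y Sy|y z Sy Sz yz].
  split; first exact: ST.
  exists (y - x); last by rewrite subrKC.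
  by apply/dilate_B2; rewrite ?mulr_gt0//; exact: Sx.
by move=> /(dilate_B2 _ d0); rewrite leNgt Ssep.
Qed.

Lemma le_expR_lne (M : \bar R) (a : R) (n : nat) :
  (lne M <= a%:E)%E -> ((n%:R)%:E <= M)%E -> n%:R <= expR a.
Proof.
move=> Ma nM; have M0 : (0 <= M)%E by apply: le_trans nM; rewrite lee_fin.
rewrite -lee_fin -[leRHS]/(expeR a%:E) (le_trans nM)// -(@lneK _ M).
  by rewrite lee_expeR.
by rewrite in_itv/= M0 leey.
Qed.

(** Points are added one at a time, skipping any within [delta] of a point already kept; kept points
    stay separated and skipped ones stay covered. *)
Lemma greedy_net (delta : R) S : 0 <= delta -> exists S' : {fset 'rV[R]_d},
  [/\ {subset S' <= S}, {in S' &, forall y z, y != z -> delta < norm2 (y - z)} &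
    forall y, y \in S -> exists2 z, z \in S' & norm2 (y - z) <= delta].
Proof.
move=> delta0; elim/fset1U_rect: S => [|x S xS [S' [S'S S'sep S'net]]].
  by exists fset0; split=> // y.
have [[z zS' xz]|far] := pselect (exists2 z, z \in S' & norm2 (x - z) <= delta).
  exists S'; split=> // [y /S'S yS|y]; first by rewrite in_fset1U yS orbT.
  by rewrite in_fset1U => /orP[/eqP->|/S'net//]; exists z.
have {}far z : z \in S' -> delta < norm2 (x - z).
  by move=> zS'; rewrite ltNge; apply/negP => xz; apply: far; exists z.
exists (x |` S')%fset; split=> [y|y z|y].
- by rewrite !in_fset1U => /orP[->//|/S'S->]; rewrite orbT.
- rewrite !in_fset1U => /orP[/eqP->|yS'] /orP[/eqP->|zS']; rewrite ?eqxx//.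
  + by move=> _; exact: far.
  + by move=> _; rewrite norm2_distC; exact: far.
  + exact: S'sep.
- rewrite in_fset1U => /orP[/eqP->|/S'net[z zS' yz]].
    by exists x; rewrite ?in_fset1U ?eqxx ?norm2_subxx.
  by exists z => //; rewrite in_fset1U zS' orbT.
Qed.

(* Each doubling of the radius costs one factor exp a: a ball of radius 2 delta
   is covered by at most exp a balls of radius delta centred in T. *)
Lemma card_packing_ball T (eps a : R) : 0 < eps ->
  (lne (Mloc T eps) <= a%:E)%E ->
  forall k x S, T x -> [set` S] `<=` T ->
    {in S &, forall y z, y != z -> eps < norm2 (y - z)} ->
    (forall y, y \in S -> norm2 (y - x) <= 2 ^+ k.+1 * eps) ->
  #|` S|%:R <= expR a ^+ k.+1.
Proof.
move=> eps0 Ma; elim=> [|k IH] x S Tx ST Ssep Sx.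
  by rewrite expr1; apply: (le_expR_lne Ma); apply: (@card_le_Mloc _ _ eps x).
pose delta := 2 ^+ k.+1 * eps.
(* [Mloc] takes a supremum over all scales from [eps] upwards, so the bound [expR a] is available
   again at scale [delta]. *)
have epsd : eps <= delta by rewrite ler_peMl ?(ltW eps0)// exprn_ege1// ler1n.
have [S' [S'S S'sep S'net]] := greedy_net S (le_trans (ltW eps0) epsd).
have S'T : [set` S'] `<=` T by move=> y /S'S /ST.
have S'a : #|` S'|%:R <= expR a.
  apply: (le_expR_lne Ma); apply: (@card_le_Mloc _ _ delta x) => // y /S'S/Sx.
  by rewrite /delta mulrA -exprS.
rewrite exprS; apply: (@le_trans _ _ (#|` S'|%:R * expR a ^+ k.+1)); last first.
  by rewrite ler_wpM2r// exprn_ge0// expR_ge0.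
apply: (@card_le_cover _ _ _ _ (fun z y => norm2 (y - z) <= delta)) => [|//|z zS'].
- by rewrite exprn_ge0// expR_ge0.
- apply: (IH z) => [|y /=|y w|y]; first exact: S'T.
  + by rewrite !inE => /andP[/ST].
  + by rewrite !inE => /andP[yS _] /andP[wS _]; exact: Ssep.
  + by rewrite !inE => /andP[].
Qed.

(** The packing may be infinite, so finite subsets are bounded first; an infinite intersection with
    the ball would contain finite subsets exceeding that bound. *)
Lemma finite_packing_ball T (eps a : R) (P : set 'rV[R]_d) x k : 0 < eps ->
  (lne (Mloc T eps) <= a%:E)%E -> packing eps T P -> T x ->
  let A := [set y | P y /\ norm2 (y - x) <= 2 ^+ k.+1 * eps] in
  finite_set A /\ forall B, B `<=` A -> #|` fset_set B|%:R <= expR a ^+ k.+1.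
Proof.
move=> eps0 Ma [PT Psep] Tx A.
have bnd (S : {fset 'rV[R]_d}) : [set` S] `<=` A -> #|` S|%:R <= expR a ^+ k.+1.
  move=> SA; apply: (card_packing_ball eps0 Ma Tx) => [y /SA[/PT]//|y z|y /SA[]//].
  by move=> /SA[Py _] /SA[Pz _] /eqP; exact: Psep.
have finA : finite_set A.
  apply: contrapT => /(infinite_set_fset (Num.bound (expR a ^+ k.+1))).
  move=> [S /bnd Sa]; rewrite -(ler_nat R) => /le_trans/(_ Sa).
  by rewrite leNgt archi_boundP// exprn_ge0// expR_ge0.
split=> // B BA; apply: bnd; rewrite fset_setK//; exact: sub_finite_set finA.
Qed.

Lemma maximal_packing_net T (eps : R) (P : set 'rV[R]_d) x : 0 <= eps ->
  maximal_packing eps T P -> T x -> exists2 y, P y & norm2 (x - y) <= eps.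
Proof.
move=> eps0 [[PT Psep] Pmax] Tx.
have [Px|nPx] := pselect (P x); first by exists x => //; rewrite norm2_subxx.
apply: contrapT => far; apply: (Pmax _ Tx nPx).
have {}far y : P y -> eps < norm2 (x - y).
  by move=> Py; rewrite ltNge; apply/negP => xy; apply: far; exists y.
split=> [y [->//|/PT//]|y z [->|Py] [->|Pz] yz]; first by [].
- exact: far.
- by rewrite norm2_distC; exact: far.
- exact: Psep.
Qed.

(** At scale |y - x| / 2 the pair {x, y} is a local packing of size 2, so exp a >= 2. This lower
    bound on [a] is what lets the Gaussian tail beat the powers of two in each annulus. *)
Lemma half_le_entropy T (eps a : R) x y : 0 < eps ->
  (lne (Mloc T eps) <= a%:E)%E -> T x -> T y -> 2 * eps <= norm2 (y - x) ->
  2^-1 <= a.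
Proof.
move=> eps0 Ma Tx Ty xy.
have yx : y != x.
  by apply/eqP => yx; move: xy; rewrite yx norm2_subxx leNgt mulr_gt0.
have : 2%:R <= expR a.
  rewrite (_ : 2%N = #|` [fset x; y]%fset|); last by rewrite cardfs2 eq_sym yx.
  apply: (le_expR_lne Ma); apply: (@card_le_Mloc _ _ (norm2 (y - x) / 2) x) => //.
  + by rewrite ler_pdivlMr// mulrC.
  + by move=> z /=; rewrite !inE => /orP[]/eqP->.
  + move=> z; rewrite !inE => /orP[]/eqP->; last by rewrite mulrC divfK.
    by rewrite norm2_subxx mulr_ge0// divr_ge0// norm2_ge0.
  + have n0 : 0 < norm2 (y - x) by rewrite (lt_le_trans _ xy)// mulr_gt0.
    move=> z w; rewrite !inE => /orP[]/eqP-> /orP[]/eqP->; rewrite ?eqxx// => _.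
      by rewrite (norm2_distC x); lra.
    by lra.
apply: contraTT; rewrite -!ltNge => a2.
(* The inequality 1 - 1/2 <= exp(-1/2) gives exp(1/2) <= 2. *)
have := expR_ge1Dx (- 2^-1 : R); rewrite expRN => h.
have e0 := expR_gt0 (2^-1 : R).
rewrite (lt_le_trans (_ : _ < expR 2^-1))//; first by rewrite ltr_expR.
rewrite -[leLHS]invrK invf_ple ?posrE ?invr_gt0//; lra.
Qed.

End local_packing.

(** * Exponential tilting of the Gaussian law *)

(* Chernoff weight of the event that eta = eta0 + v beats eta0. *)
Definition tilt {R : realType} {d} (s : R) (theta v Y : 'rV[R]_d) : R :=
  expR ((\sum_i v 0 i * (Y 0 i - theta 0 i) - norm2 v ^+ 2 / 4) / (4 * s ^+ 2)).

Section tilt_theory.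
Context {R : realType} {d : nat}.
Variables (s : R) (theta : 'rV[R]_d).
Hypothesis s0 : 0 < s.
Implicit Types v Y : 'rV[R]_d.

Let dotZ k v Y : \sum_i (k *: v) 0 i * Y 0 i = k * \sum_i v 0 i * Y 0 i.
Proof. by rewrite mulr_sumr; apply: eq_bigr => i _; rewrite mxE mulrA. Qed.

Let tiltE v Y : tilt s theta v Y =
  expR (- (\sum_i v 0 i * theta 0 i + norm2 v ^+ 2 / 4) / (4 * s ^+ 2)) *
  expR (\sum_i ((4 * s ^+ 2)^-1 *: v) 0 i * Y 0 i).
Proof.
rewrite -expRD dotZ; congr expR; under eq_bigr do rewrite mulrBr.
by rewrite sumrB; field; rewrite ?gt_eqF.
Qed.

Lemma measurable_tilt v : measurable_fun [set: 'rV[R]_d] (tilt s theta v).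
Proof.
rewrite (funext (tiltE v)).
by apply: measurable_funM => //; exact: measurable_expR_dot.
Qed.

(** The terms in [theta] cancel, leaving the exponent |v|^2 / (32 s^2) - |v|^2 / (16 s^2). The
    factor 1 / (4 s^2) in [tilt] is the Chernoff parameter that minimises it. *)
Lemma integral_tilt v : (\int[isogauss s theta]_Y (tilt s theta v Y)%:E =
  (expR (- norm2 v ^+ 2 / (32 * s ^+ 2))%R)%:E)%E.
Proof.
under eq_integral do rewrite tiltE EFinM.
rewrite ge0_integralZl//=; last first.
  by apply/measurable_EFinP; exact: measurable_expR_dot.
rewrite isogauss_mgf ?gt_eqF// -EFinM -expRD; congr (expR _)%:E.
rewrite dotZ; under [in X in _ * X / 2]eq_bigr do rewrite mxE exprMn.
by rewrite -mulr_sumr -sqr_norm2; field; rewrite ?gt_eqF.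
Qed.

Lemma tilt_ge1 (eta0 eta Y : 'rV[R]_d) :
  norm2 (eta - Y) ^+ 2 <= norm2 (eta0 - Y) ^+ 2 ->
  8 * norm2 (theta - eta0) <= norm2 (eta - eta0) ->
  1 <= tilt s theta (eta - eta0) Y.
Proof.
move=> closer far; rewrite -expR0 ler_expR divr_ge0 ?mulr_ge0 ?(ltW s0)//.
have D2 : 64 * norm2 (theta - eta0) ^+ 2 <= norm2 (eta - eta0) ^+ 2.
  have := norm2_ge0 (theta - eta0); have := norm2_ge0 (eta - eta0); nra.
(* Put u = eta - eta0 and w = theta - eta0. As eta is at least as close to Y as eta0, |u|^2 <= 2 <u,
   Y - eta0> = 2 <u, Y - theta> + 2 <u, w>, and |u - 8 w|^2 >= 0 bounds 2 <u, w> by |u|^2 / 8 + 8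
   |w|^2. *)
have split : norm2 (eta - eta0) ^+ 2 <=
    2 * (\sum_i (eta - eta0) 0 i * (Y 0 i - theta 0 i)) +
    (norm2 (eta - eta0) ^+ 2 / 8 + 8 * norm2 (theta - eta0) ^+ 2).
  apply: (@le_trans _ _ (norm2 (eta - eta0) ^+ 2 +
      norm2 (eta0 - Y) ^+ 2 - norm2 (eta - Y) ^+ 2)); first by lra.
  rewrite !sqr_norm2 mulr_suml !mulr_sumr -sumrN -!big_split/=.
  apply: ler_sum => i _; rewrite !mxE.
  have := sqr_ge0 ((eta 0 i - eta0 0 i) - 8 * (theta 0 i - eta0 0 i)); lra.
by have := sqr_ge0 (norm2 (eta - eta0)); lra.
Qed.

End tilt_theory.

(** * Dyadic scales and the tail of one annulus *)

(** Take the least [j] satisfying the upper bound: minimality gives the lower bound, except at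
    [j = 0], where it is [r <= x]. *)
Lemma dyadic_scale (R : realType) (r x : R) : 0 < r -> r <= x ->
  exists j, 2 ^+ j * r <= x < 2 ^+ j.+1 * r.
Proof.
move=> r0 rx; have x0 : 0 <= x / r by rewrite divr_ge0 ?(le_trans _ rx) ?ltW.
have ex : exists j, x < 2 ^+ j.+1 * r.
  exists (Num.bound (x / r)).
  rewrite -ltr_pdivrMr// (lt_le_trans (archi_boundP x0))//.
  by rewrite -natrX ler_nat ltnW// ltnW// ltn_expl.
case: (ex_minnP ex) => j xj jmin; exists j; rewrite xj andbT.
case: j xj jmin => [|j] xj jmin; first by rewrite mul1r.
by rewrite leNgt; apply/negP => /jmin; rewrite ltnn.
Qed.

(* The offset 6, i.e. the radius 64 eps, is chosen so that 128 * 4 ^ j =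
   4 ^ (j + 6) / 32 outgrows the entropy j + 7 already at j = 0. *)
Lemma annulus_tail (R : realType) (a eps s D : R) (j : nat) :
  0 < s -> 0 < eps -> a = eps ^+ 2 / s ^+ 2 -> 2^-1 <= a ->
  2 ^+ (j + 6) * eps <= D <= 2 ^+ (j + 7) * eps ->
  expR a ^+ (j + 7) * (2 * D ^+ 2 * expR (- D ^+ 2 / (32 * s ^+ 2))) <=
    eps ^+ 2 / (2 ^ j.+1)%:R.
Proof.
move=> s0 e0 aE a2 /andP[Dlo Dhi].
have D0 : 0 <= D by rewrite (le_trans _ Dlo)// mulr_ge0 ?exprn_ge0 ?ltW.
have p4 : (2 ^+ j) ^+ 2 = 4 ^+ j :> R.
  by rewrite -exprM mulnC exprM; congr (_ ^+ _); ring.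
have Dhi2 : D ^+ 2 <= (2 ^+ (j + 7)) ^+ 2 * eps ^+ 2.
  by rewrite -exprMn ler_pXn2r ?nnegrE// mulr_ge0 ?exprn_ge0 ?ltW.
have Dlo2 : (2 ^+ (j + 6)) ^+ 2 * eps ^+ 2 <= D ^+ 2.
  by rewrite -exprMn ler_pXn2r ?nnegrE// mulr_ge0 ?exprn_ge0 ?ltW.
have tail : expR (- D ^+ 2 / (32 * s ^+ 2)) <= expR (- (128 * 4 ^+ j) * a).
  rewrite ler_expR mulNr mulNr lerN2 aE ler_pdivlMr ?mulr_gt0 ?exprn_gt0//.
  apply: le_trans Dlo2; rewrite exprD exprMn p4 le_eqVlt; apply/orP; left.
  by apply/eqP; field; rewrite ?gt_eqF.
(* The exponent 3 j + 16 collects 2 (j + 7) from [D ^+ 2], 1 from the factor 2, and j + 1 from the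
   claimed bound. It is reached because e >= 2, 4^j >= j + 1 and a >= 1/2. *)
have key : (2 : R) ^+ (3 * j + 16) <= expR ((128 * 4 ^+ j - (j + 7)%:R) * a).
  apply: (@le_trans _ _ (expR (3 * j + 16)%:R)).
    rewrite -[X in expR X]mulr1 expRM_natl lerXn2r ?nnegrE ?expR_ge0//.
    by rewrite (le_trans _ (expR_ge1Dx _)).
  rewrite ler_expR.
  have j4 : j.+1%:R <= (4 : R) ^+ j by rewrite -natrX ler_nat ltn_expl.
  rewrite -natr1 in j4; rewrite (natrD _ (3 * j)) natrM (natrD _ j).
  have := ler0n R j; nra.
apply: (@le_trans _ _ (expR a ^+ (j + 7) * (2 * ((2 ^+ (j + 7)) ^+ 2 * eps ^+ 2) *
    expR (- (128 * 4 ^+ j) * a)))).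
  rewrite ler_wpM2l ?exprn_ge0 ?expR_ge0// ler_pM ?expR_ge0 ?mulr_ge0 ?sqr_ge0//.
  by rewrite ler_wpM2l.
rewrite -expRM_natl ler_pdivlMr ?ltr0n ?expn_gt0//.
rewrite [leLHS](_ : _ = eps ^+ 2 * (2 ^+ (3 * j + 16) /
    expR ((128 * 4 ^+ j - (j + 7)%:R) * a))).
  by rewrite ger_pMr ?exprn_gt0// ler_pdivrMr ?expR_gt0// mul1r.
rewrite -expRN natrX (_ : (3 * j + 16 = (j + 7) * 2 + 1 + j.+1)%N); last lia.
rewrite (exprD _ ((j + 7) * 2 + 1)) (exprD _ ((j + 7) * 2)) exprM.
rewrite [in RHS](_ : - _ = (j + 7)%:R * a + - (128 * 4 ^+ j) * a); last by ring.
rewrite expRD; ring.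
Qed.

Lemma nneseries_ge_term (R : realType) (u : (\bar R)^nat) (j : nat) :
  (forall n, 0 <= u n)%E -> (u j <= \sum_(n <oo) u n)%E.
Proof.
move=> u0; apply: le_trans (nneseries_lim_ge j.+1 _) => //.
by rewrite big_nat_recr//= leeDr// sume_ge0.
Qed.

(** * A random majorant of the squared error and its expectation *)

Section risk.
Context {R : realType} {d : nat}.
Variables (T : set 'rV[R]_d) (s eps a : R) (P : set 'rV[R]_d).
Variables (thetahat : 'rV[R]_d -> 'rV[R]_d) (theta eta0 : 'rV[R]_d).
Hypotheses (s0 : 0 < s) (eps0 : 0 < eps) (aE : a = eps ^+ 2 / s ^+ 2).
Hypotheses (Ma : (lne (Mloc T eps) <= a%:E)%E) (packP : packing eps T P).
Hypothesis argminP : forall Y,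
  argmin P (fun eta => norm2 (eta - Y) ^+ 2) (thetahat Y).
Hypotheses (Peta0 : P eta0) (near_eta0 : norm2 (theta - eta0) <= eps).

(** Both ends are closed, so annuli may share points; double counting only enlarges the majorant. *)
Let annulus (j : nat) : set 'rV[R]_d :=
  [set eta | P eta /\
    2 ^+ (j + 6) * eps <= norm2 (eta - eta0) <= 2 ^+ (j + 7) * eps].

Let weight (eta Y : 'rV[R]_d) : R :=
  2 * norm2 (eta - eta0) ^+ 2 * tilt s theta (eta - eta0) Y.

Let weight_ge0 eta Y : 0 <= weight eta Y.
Proof. by rewrite !mulr_ge0 ?norm2_ge0 ?expR_ge0. Qed.

(** [fset_set] is empty on an infinite set; the finiteness in [card_annulus] ensures that no term is
    lost. *)
Let shell (j : nat) (Y : 'rV[R]_d) : \bar R :=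
  (\sum_(eta <- fset_set (annulus j)) (weight eta Y)%:E)%E.

Let shell_ge0 j Y : (0 <= shell j Y)%E.
Proof. by apply: sume_ge0 => eta _; rewrite lee_fin weight_ge0. Qed.

Let measurable_weight eta :
  measurable_fun [set: 'rV[R]_d] (fun Y => (weight eta Y)%:E).
Proof.
by apply/measurable_EFinP; apply: measurable_funM => //; exact: measurable_tilt.
Qed.

Let measurable_shell j : measurable_fun [set: 'rV[R]_d] (shell j).
Proof. exact: emeasurable_sum. Qed.

Let card_annulus j : finite_set (annulus j) /\
  #|` fset_set (annulus j)|%:R <= expR a ^+ (j + 7).
Proof.
have [PT _] := packP; rewrite addnS.
have [fin card] := finite_packing_ball (j + 6) eps0 Ma packP (PT _ Peta0).
have sub : annulus j `<=`
    [set y | P y /\ norm2 (y - eta0) <= 2 ^+ (j + 6).+1 * eps].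
  by move=> y [Py /andP[_ yD]]; split=> //; rewrite -addnS.
by split; [exact: sub_finite_set fin|exact: card].
Qed.

Let integral_shell j :
  (\int[isogauss s theta]_Y shell j Y <= (eps ^+ 2 / (2 ^ j.+1)%:R)%:E)%E.
Proof.
have [fin card] := card_annulus j.
rewrite ge0_integral_sum//; last by move=> eta Y _; rewrite lee_fin weight_ge0.
(* Dividing by the cardinality bound here makes it cancel when the terms are summed over the
   annulus. *)
have bnd eta : eta \in fset_set (annulus j) ->
    (\int[isogauss s theta]_Y (weight eta Y)%:E <=
     (eps ^+ 2 / (2 ^ j.+1)%:R / expR a ^+ (j + 7))%:E)%E.
  rewrite in_fset_set// inE => -[Peta etaD].
  under eq_integral do rewrite EFinM.
  rewrite ge0_integralZl//=; last 3 first.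
  - by apply/measurable_EFinP; exact: measurable_tilt.
  - by move=> Y _; rewrite lee_fin expR_ge0.
  - by rewrite lee_fin mulr_ge0 ?sqr_ge0.
  rewrite integral_tilt// -EFinM lee_fin ler_pdivlMr ?exprn_gt0 ?expR_gt0//.
  rewrite mulrC; apply: annulus_tail => //.
  (* The bound 1/2 <= a comes from [eta] itself, which lies at distance at least 64 eps from
     [eta0]. *)
  have [PT _] := packP; apply: (half_le_entropy eps0 Ma (PT _ Peta0) (PT _ Peta)).
  have /andP[+ _] := etaD; apply: le_trans; rewrite ler_pM2r//.
  by rewrite -[leLHS]expr1 ler_eXn2l ?ltr1n//; lia.
rewrite big_seq; apply: (le_trans (lee_sum _ bnd)); rewrite -big_seq.
rewrite sumEFin lee_fin big_const_seq count_predT iter_addr_0 -[leLHS]mulr_natr.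
rewrite -(mulrA (_ / _)) ler_piMr ?divr_ge0 ?sqr_ge0//.
by rewrite mulrC ler_pdivrMr ?exprn_gt0 ?expR_gt0// mul1r.
Qed.

(** With D = |thetahat Y - eta0|, the squared error is at most 2 D^2 + 2 eps^2. If D < 64 eps this
    is at most (2^13 + 2) eps^2; otherwise 2 D^2 is at most the weight of [thetahat Y], one term of
    the shell of an annulus containing it. *)
Let pointwise Y : ((norm2 (thetahat Y - theta) ^+ 2)%:E <=
  ((2 ^+ 13 + 2) * eps ^+ 2)%:E + \sum_(j <oo) shell j Y)%E.
Proof.
have [Phat hatmin] := argminP Y; set D := norm2 (thetahat Y - eta0).
have D0 : 0 <= D by exact: norm2_ge0.
have split := sqr_norm2D_le (thetahat Y) eta0 theta; rewrite -/D in split.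
have t2 : norm2 (theta - eta0) ^+ 2 <= eps ^+ 2.
  by rewrite lerXn2r ?nnegrE ?norm2_ge0 ?(ltW eps0).
have [small|large] := ltP D (64 * eps).
  have D2 : D ^+ 2 <= 2 ^+ 12 * eps ^+ 2 by nra.
  apply: (@le_trans _ _ ((2 ^+ 13 + 2) * eps ^+ 2)%:E).
    by rewrite lee_fin; lra.
  by rewrite leeDl// nneseries_ge0.
have r0 : 0 < 64 * eps by rewrite mulr_gt0.
have [j /andP[jlo jhi]] := dyadic_scale r0 large.
have inj : annulus j (thetahat Y).
  split=> //; rewrite !exprD -/D; apply/andP; split.
    by move: jlo; rewrite (_ : 2 ^+ j * (64 * eps) = 2 ^+ j * 2 ^+ 6 * eps)//; ring.
  move: jhi => /ltW; rewrite (_ : _ * (64 * eps) = 2 ^+ j * 2 ^+ 7 * eps)//.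
  by rewrite exprS; ring.
have [fin _] := card_annulus j.
have tilt1 : 1 <= tilt s theta (thetahat Y - eta0) Y.
  apply: tilt_ge1 => //; first exact: hatmin.
  by have := near_eta0; have := eps0; rewrite -/D; lra.
apply: (@le_trans _ _ ((2 * eps ^+ 2)%:E + (2 * D ^+ 2)%:E)%E).
  by rewrite -EFinD lee_fin; lra.
apply: leeD; first by rewrite lee_fin; have := sqr_ge0 eps; lra.
apply: le_trans (nneseries_ge_term j (shell_ge0 ^~ Y)).
rewrite /shell (big_fsetD1 (thetahat Y))/=; last by rewrite in_fset_set// inE.
rewrite -[leLHS]adde0; apply: leeD; last first.
  by apply: sume_ge0 => eta _; rewrite lee_fin.
by rewrite lee_fin ler_peMr// mulr_ge0// sqr_ge0.
Qed.

Lemma gaussian_risk_le :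
  ('E_(isogauss s theta)[fun Y => (norm2 (thetahat Y - theta) ^+ 2)%R] <=
   ((2 ^+ 13 + 3) * eps ^+ 2)%:E)%E.
Proof.
rewrite unlock; have pw := pointwise.
set c := (2 ^+ 13 + 2) * eps ^+ 2 in pw.
have -> : (2 ^+ 13 + 3) * eps ^+ 2 = c + eps ^+ 2 by rewrite /c; ring.
have c0 : (0 <= c%:E)%E by rewrite lee_fin mulr_ge0 ?sqr_ge0// addr_ge0// exprn_ge0.
(* Passing to the measurable majorant makes additivity of the integral available. *)
clearbody c; apply: le_trans (ge0_le_integral_lower _ _ pw) _.
  by move=> Y; rewrite lee_fin sqr_ge0.
rewrite ge0_integralD//; last 2 first.
- by move=> Y _; exact: nneseries_ge0.
- by apply: ge0_emeasurable_sum => // *; exact: shell_ge0.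
rewrite integral_cst// [X in (_ * X + _)%E](_ : _ = 1%E); last first.
  exact: probability_setT.
rewrite mule1 integral_nneseries//.
rewrite EFinD leeD2l//.
(* The annuli contribute at most the geometric series of terms eps^2 / 2^(j+1), whose sum eps^2
   raises the constant to 2^13 + 3. *)
apply: le_trans (epsilon_trick0 _ (sqr_ge0 eps)).
by apply: lee_nneseries => j *; [exact: integral_ge0|exact: integral_shell].
Qed.

End risk.

(** * The universal constant and the supremum over [T] *)

Theorem propositionA1 (R : realType) :
  exists C : R, 0 < C /\
    forall (d : nat) (T : set 'rV[R]_d) (sigma eps : R)
      (Meps : set 'rV[R]_d) (thetahat : 'rV[R]_d -> 'rV[R]_d),
    T !=set0 -> 0 < sigma -> 0 < eps ->
    (lne (Mloc T eps) <= (eps ^+ 2 / sigma ^+ 2)%:E)%E ->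
    maximal_packing eps T Meps ->
    (forall Y, argmin Meps (fun eta => norm2 (eta - Y) ^+ 2) (thetahat Y)) ->
    (ereal_sup [set 'E_(isogauss sigma theta)
                      [fun Y => (norm2 (thetahat Y - theta) ^+ 2)%R] | theta in T]
       <= (C * eps ^+ 2)%:E)%E.
Proof.
exists (2 ^+ 13 + 3); split=> [|d T s eps P thetahat _ s0 eps0 Ma maxP amin].
  by rewrite addr_gt0// exprn_gt0.
apply: ge_ereal_sup => _ [theta Ttheta <-].
(* The reference point [eta0] depends on [theta], but the resulting constant does not. *)
have [eta0 Peta0 near] := maximal_packing_net (ltW eps0) maxP Ttheta.
exact: gaussian_risk_le s0 eps0 erefl Ma maxP.1 amin Peta0 near.
Qed.
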